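(* Let $G$ be a simple graph of order $n\ge 2$. Then: (i) $st_{\gamma_2}(G)\le n-1$; (ii) if $G$ has the star graph $K_{1,t}$ as an induced subgraph with $t\ge 3$, then $st_{\gamma_2}(G)\le n-t$.
   Context: All graphs are finite, simple and undirected. For a graph $G=(V,E)$, a subset $D \subseteq V$ is a 2-dominating set if every vertex $v \in V \setminus D$ has at least two neighbors in $D$. The 2-domination number $\gamma_2(G)$ is the minimum cardinality of a 2-dominating set of $G$. The stability of the 2-domination number, $st_{\gamma_2}(G)$, is the minimum number of vertices whose removal from $G$ (deleting the vertices and all incident edges) changes the 2-domination number, i.e. the minimum of $|S|$ over $S\subseteq V$ with $\gamma_2(G-S)\ne\gamma_2(G)$. *)

(* Defs.v *)
From mathcomp Require Import all_boot.

Set Implicit Arguments.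
Unset Strict Implicit.
Unset Printing Implicit Defensive.

Record sgraph := SGraph {
  vertex :> finType;
  adj : rel vertex;
  adj_sym : symmetric adj;
  adj_irrefl : irreflexive adj
}.

Definition isomorphic (G H : sgraph) : Prop :=
  exists2 f : G -> H, bijective f & forall x y, adj (f x) (f y) = adj x y.

Section Induced.
Variables (G : sgraph) (W : {set G}).

Definition induced_adj : rel {x : G | x \in W} :=
  fun x y => adj (val x) (val y).

Lemma induced_adj_sym : symmetric induced_adj.
Proof. by move=> x y; apply: adj_sym. Qed.

Lemma induced_adj_irrefl : irreflexive induced_adj.
Proof. by move=> x; apply: adj_irrefl. Qed.

Definition induced : sgraph := SGraph induced_adj_sym induced_adj_irrefl.
End Induced.

Definition del_vertices (G : sgraph) (S : {set G}) : sgraph := induced (~: S).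

Definition has_induced_subgraph (G H : sgraph) : Prop :=
  exists W : {set G}, isomorphic (induced W) H.

(* The star K_{1,t}: [None] is the centre, [Some i] for i < t are the leaves. *)
Section Star.
Variable t : nat.

Definition star_adj : rel (option 'I_t) := fun x y => isSome x (+) isSome y.

Lemma star_adj_sym : symmetric star_adj.
Proof. by move=> x y; apply: addbC. Qed.

Lemma star_adj_irrefl : irreflexive star_adj.
Proof. by move=> x; apply: addbb. Qed.

Definition star : sgraph := SGraph star_adj_sym star_adj_irrefl.
End Star.

Definition two_dominating (G : sgraph) (D : {set G}) : bool :=
  [forall v, (v \notin D) ==> (2 <= #|[set u in D | adj v u]|)].

(* The default [setT] is always 2-dominating, so this is a genuine minimum
   (equal to 0 on the graph without vertices). *)
Definition gamma2 (G : sgraph) : nat :=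
  #|[arg min_(D < [set: G] | two_dominating D) #|D|]|.

(* S may be all of V. The default [setT] satisfies the condition as soon as G
   has a vertex, since then gamma2 (G - V) = 0 < gamma2 G; this is therefore a
   genuine minimum on every nonempty graph. *)
Definition st_gamma2 (G : sgraph) : nat :=
  #|[arg min_(S < [set: G] | gamma2 (del_vertices S) != gamma2 G) #|S|]|.

(* Main.v *)
(** A 2-dominating set contains every vertex of degree at most one, so
    [gamma2 (star s) = s] for [s >= 2].  Hence an induced [star t] with
    [t >= 3] contains both a set of [t + 1] and a set of [t] vertices, inducing
    graphs with the distinct 2-domination numbers [t] and [t - 1].  At least
    one of them differs from [gamma2 G], and its complement has at most [n - t]
    vertices.  For the first bound, keep a single vertex: [gamma2 G >= 2]. *)
Require Import Defs.
From mathcomp Require Import all_boot.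

Lemma two_dominatingT (G : sgraph) : two_dominating [set: G].
Proof. by apply/forallP=> v; rewrite inE. Qed.

Lemma gamma2_le (G : sgraph) (D : {set G}) :
  two_dominating D -> gamma2 G <= #|D|.
Proof.
rewrite /gamma2; case: arg_minnP => [|D0 _ minD0]; first exact: two_dominatingT.
exact: minD0.
Qed.

Lemma gamma2_ge (G : sgraph) (k : nat) :
  (forall D : {set G}, two_dominating D -> k <= #|D|) -> k <= gamma2 G.
Proof.
rewrite /gamma2; case: arg_minnP => [|D0 domD0 _]; first exact: two_dominatingT.
exact.
Qed.

(** Only neighbours inside [D] are counted, so this serves both for vertices of degree at most one
    and for sets [D] with at most one element. *)
Lemma two_dominating_degree (G : sgraph) (D : {set G}) (v : G) :
  two_dominating D -> #|[set u in D | adj v u]| <= 1 -> v \in D.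
Proof.
move=> /forallP/(_ v) + le1; case: (v \in D) => //=.
by rewrite leqNgt ltnS le1.
Qed.

(** With at most one element in [D], no vertex has two neighbours in [D], so [D] must be the whole
    vertex set. *)
Lemma gamma2_ge_minn2 (G : sgraph) : minn 2 #|G| <= gamma2 G.
Proof.
apply: gamma2_ge => D domD; rewrite leqNgt leq_min ltnS; apply/negP.
case/andP=> D1; have -> : D = setT.
  apply/setP=> v; rewrite inE; apply: (two_dominating_degree _ _ _ domD).
  apply: leq_trans D1; apply/subset_leq_card/subsetP => u.
  by rewrite inE => /andP[].
by rewrite cardsT ltnn.
Qed.

Lemma gamma2_le_card (G : sgraph) : gamma2 G <= #|G|.
Proof. by rewrite -cardsT; apply: gamma2_le; apply: two_dominatingT. Qed.

Lemma st_gamma2_keep (G : sgraph) (W : {set G}) : 0 < #|G| ->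
  gamma2 (induced W) != gamma2 G -> st_gamma2 G <= #|G| - #|W|.
Proof.
move=> G0 neqW; have <- : #|~: W| = #|G| - #|W| by rewrite cardsCs setCK.
rewrite /st_gamma2; case: arg_minnP => [|S _ minS]; last first.
  by apply: minS; rewrite /del_vertices setCK.
(* What remains is the default [setT] of the minimum: removing every vertex leaves 2-domination
   number 0, while that of [G] is positive. *)
rewrite neq_ltn; apply/orP; left.
apply: leq_trans (gamma2_ge_minn2 G).
apply: (@leq_ltn_trans 0); last by rewrite leq_min G0.
by apply: leq_trans (gamma2_le_card _) _; rewrite card_sig eq_card0 // => x;
  rewrite !inE.
Qed.

Lemma card_sub_preim (G : sgraph) (W A : {set G}) : A \subset W ->
  #|[set x : induced W | val x \in A]| = #|A|.
Proof.
move=> sAW; rewrite -(card_imset _ val_inj); apply: eq_card => y.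
apply/imsetP/idP => [[x + ->]|yA]; first by rewrite inE.
by exists (Sub y (subsetP sAW y yA)); rewrite ?inE ?SubK.
Qed.

(** The leaves 2-dominate the centre because there are at least two of them, and each leaf is forced
    since its only neighbour is the centre. Phrasing it with [c] and [L] inside [G] lets it apply
    again after a leaf is dropped. *)
Lemma gamma2_induced_star (G : sgraph) (c : G) (L : {set G}) :
  2 <= #|L| -> {in L, forall x, adj c x} ->
  {in L &, forall x y, ~~ adj x y} -> gamma2 (induced (c |: L)) = #|L|.
Proof.
move=> L2 adjcL indL.
have cW : c \in c |: L by rewrite setU11.
pose c' : induced (c |: L) := Sub c cW.
pose L' := [set x : induced (c |: L) | val x \in L].
have cardL' : #|L'| = #|L| by apply: card_sub_preim; apply: subsetUr.
have caseW (x : induced (c |: L)) : x = c' \/ x \in L'.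
  case/setU1P: (valP x) => [xc|xL]; [left; exact: val_inj|right].
  by rewrite inE.
apply/eqP; rewrite eqn_leq; apply/andP; split.
  rewrite -cardL'; apply: gamma2_le; apply/forallP => v; apply/implyP.
  case: (caseW v) => [-> _|->//].
  rewrite (_ : [set u in L' | _] = L') ?cardL' //.
  apply/setP=> u; rewrite inE andb_idr // inE; exact: adjcL.
apply: gamma2_ge => D domD; rewrite -cardL'; apply/subset_leq_card/subsetP.
move=> x xL'; apply: (two_dominating_degree _ _ _ domD).
(* All neighbours of the leaf [x] lie in the singleton of [c'], as leaves are pairwise
   non-adjacent. *)
rewrite -(cards1 c'); apply/subset_leq_card/subsetP => u.
rewrite !inE => /andP[_ xu]; case: (caseW u) => [->|uL'] //.
by move: xL' uL'; rewrite !inE => xL uL; case/negP: (indL _ _ xL uL).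
Qed.

(** The inverse [g] of the isomorphism carries the centre and the leaves back to vertices of [G]. *)
Lemma induced_starP (G : sgraph) (t : nat) :
  has_induced_subgraph G (star t) ->
  exists (c : G) (L : {set G}),
    [/\ #|L| = t, {in L, forall x, adj c x}
      & {in L &, forall x y, ~~ adj x y}].
Proof.
case=> W [f [g fK gK] fadj].
have gadj x y : adj (val (g x)) (val (g y)) = star_adj x y.
  by have := fadj (g x) (g y); rewrite !gK.
exists (val (g None)), [set val (g (Some i)) | i : 'I_t]; split.
- rewrite card_imset ?card_ord // => i j /val_inj /(can_inj gK) [] //.
- by move=> _ /imsetP[i _ ->]; rewrite gadj.
- by move=> _ _ /imsetP[i _ ->] /imsetP[j _ ->]; rewrite gadj.
Qed.

Theorem theorem3p2 (G : sgraph) (n : nat) (hG : #|G| = n) (hn : 2 <= n) :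
  st_gamma2 G <= n - 1 /\
  (forall t : nat, 3 <= t -> has_induced_subgraph G (star t) ->
     st_gamma2 G <= n - t).
Proof.
rewrite -{n}hG in hn *; have G0 : 0 < #|G| := ltnW hn.
split=> [|t t3 /induced_starP[c [L [cardL adjcL indL]]]].
  have /card_gt0P[x _] := G0.
  rewrite -(cards1 x); apply: st_gamma2_keep => //.
  rewrite neq_ltn; apply/orP; left.
  apply: leq_trans (gamma2_ge_minn2 G); rewrite (minn_idPl hn) ltnS.
  by apply: leq_trans (gamma2_le_card _) _; rewrite card_sig cards1.
have cL (A : {set G}) : A \subset L -> c \notin A.
  move=> /subsetP sAL; apply/negP => /sAL/adjcL.
  by rewrite adj_irrefl.
have [gt|neq] := eqVneq (gamma2 G) t; last first.
  (* Keeping the whole star, with [t + 1] vertices, even gives the bound [n - (t + 1)]. *)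
  apply: leq_trans (st_gamma2_keep _ (c |: L) G0 _) _.
    by rewrite gamma2_induced_star ?cardL 1?eq_sym // ltnW.
  by rewrite cardsU1 cL // cardL leq_sub2l // leq_addl.
(* Now [gamma2 G = t], so a leaf [l] is dropped: the smaller star has [t] vertices and 2-domination
   number [t - 1]. Here [3 <= t] ensures that two leaves remain. *)
have /card_gt0P[l lL] : 0 < #|L| by rewrite cardL; apply: leq_trans t3.
have sDL : L :\ l \subset L by apply: subsetDl.
have cardD : #|L :\ l|.+1 = t by rewrite -cardL (cardsD1 l L) lL.
have <- : #|c |: (L :\ l)| = t by rewrite cardsU1 cL.
apply: st_gamma2_keep => //; rewrite gt gamma2_induced_star.
- by rewrite -cardD neq_ltn ltnSn.
- by rewrite -ltnS cardD.
- by move=> x /(subsetP sDL)/adjcL.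
- by move=> x y /(subsetP sDL) xL /(subsetP sDL); apply: indL.
Qed.
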